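(* Let $p:(\mathbb{R}^d\times\mathbb{R}\times\mathbb{R}^d)^2\to\mathbb{R}^\ell$ be a pairwise constraint. If $p$ is regularly extensible, then $p$ is an interpolation constraint for $\mathcal{F}^m_p(\mathbb{R}^d)$.
   Context: Fix $d\ge 1$ and consider $\mathbb{R}^d$ with its Euclidean structure. A pairwise constraint is a map $p:(\mathbb{R}^d\times\mathbb{R}\times\mathbb{R}^d)^2\to\mathbb{R}^\ell$, $\ell\geq 1$; inequalities $p(\cdot,\cdot)\ge 0$ are elementwise. For $\mathcal{X}\subseteq\mathbb{R}^d$, a mapping $F=(f,g):\mathcal{X}\rightrightarrows\mathbb{R}\times\mathbb{R}^d$ assigns to each $x\in\mathcal{X}$ the set $F(x)=\{f(x)\}\times g(x)$, where $f(x)\in\mathbb{R}$ is single-valued and $g(x)\subseteq\mathbb{R}^d$ is nonempty and possibly multi-valued. Any element of $F(x)$ is denoted $F_x$. $\mathrm{Graph}\,F=\{(x,F_x): x\in\mathcal{X},\ F_x\in F(x)\}$. Define $\mathcal{F}_p(\mathcal{X})$ as the set of mappings $F:\mathcal{X}\rightrightarrows\mathbb{R}\times\mathbb{R}^d$ such that $p((x_1,F_{x_1}),(x_2,F_{x_2}))\ge 0$ for all $x_1,x_2\in\mathcal{X}$ and all $F_{x_i}\in F(x_i)$, $i=1,2$. Define $\mathcal{F}^m_p(\mathbb{R}^d)$ as the set of maximal elements: those $F\in\mathcal{F}_p(\mathbb{R}^d)$ for which there is no $\bar F\in\mathcal{F}_p(\mathbb{R}^d)$ with $\mathrm{Graph}\,F\subsetneq\mathrm{Graph}\,\bar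 F$. When $\mathcal{X}$ is finite, mappings $F\in\mathcal{F}_p(\mathcal{X})$ correspond to finite datasets $\{(x_i,f_i,g_i)\}$ (the same $x_i$ may appear with several $g_i$). Interpolation constraint: $p$ is an interpolation constraint for $\mathcal{F}^m_p(\mathbb{R}^d)$ if for every finite $\mathcal{X}\subset\mathbb{R}^d$ and every $F\in\mathcal{F}_p(\mathcal{X})$ there exists $\bar F\in\mathcal{F}^m_p(\mathbb{R}^d)$ such that $F(x)=\bar F(x)$ for all $x\in\mathcal{X}$. Regularly extensible: $p$ is regularly extensible if (1) $p$ is continuous, and (2) for every finite $\mathcal{X}\subset\mathbb{R}^d$ and every $F\in\mathcal{F}_p(\mathcal{X})$, there exists $\bar F\in\mathcal{F}_p(\mathbb{Q}^d\cup\mathcal{X})$ with $\bar F(x)=F(x)$ for all $x\in\mathcal{X}$, such that alongside any Cauchy sequence $(x_k)_{k=1,2,\ldots}\subset\mathbb{Q}^d$, there exists a convergent subsequence in $(\bar F(x_k))_{k=1,2,\ldots}$ (for any selection $\bar F_{x_k}\in\bar F(x_k)$, convergence being in $\mathbb{R}\times\mathbb{R}^d$).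
   Formalization: Interpolation is taken as F(x) ⊆ F̄(x) (data lie on the graph of F̄, function values agree) instead of F(x) = F̄(x), which fails e.g. for p = 0, where every maximal F̄ has ḡ(x) = R^d; mappings over finite X are read as finite datasets. *)

(* Defs.v *)
From HB Require Import structures.
From mathcomp Require Import all_boot all_order all_algebra.
From mathcomp Require Import all_classical all_reals all_analysis.

Set Implicit Arguments.
Unset Strict Implicit.
Unset Printing Implicit Defensive.

Import Order.TTheory GRing.Theory Num.Theory.
Import numFieldNormedType.Exports.

Local Open Scope classical_set_scope.
Local Open Scope ring_scope.

Section PairwiseConstraints.
Context {R : realType} {d : nat}.

(* [R^d] is ['rV[R]_d]; its norm in the library is the sup norm, but only the
   topology and uniformity, which are the Euclidean ones, are used. *)
Local Notation E := 'rV[R]_d.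

(* [(x, (f, g))] stands for the triple [(x, f, g)], so that [(x, F_x)] with
   [F_x] in [F(x)] is a point of this type. *)
Definition datum : Type := (E * (R * E))%type.

(* A set-valued map [F = (f, g)] with [f] single-valued, represented by total
   data on [R^d]; the values outside its domain [X] are junk and are never
   inspected below. *)
Record mapping := Mapping { fval : E -> R ; gval : E -> set E }.

Definition values (F : mapping) (x : E) : set (R * E) :=
  [set fval F x] `*` gval F x.

Definition graph (X : set E) (F : mapping) : set datum :=
  [set z | X z.1 /\ values F z.1 z.2].

Definition rational_points : set E :=
  range (map_mx ratr : 'rV[rat]_d -> 'rV[R]_d).

Definition has_cvg_subseq (y : nat -> R * E) : Prop :=
  exists (phi : nat -> nat) (z : R * E),
    {homo phi : m n / (m < n)%N} /\ (y \o phi) @ \oo --> z.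

Section Constraint.
Context {l : nat}.
Variable p : datum * datum -> 'rV[R]_l.

Definition constraint_class (X : set E) : set mapping :=
  [set F | (forall x, X x -> gval F x !=set0) /\
    forall x1 x2 y1 y2, X x1 -> X x2 -> values F x1 y1 -> values F x2 y2 ->
      forall i, 0 <= p ((x1, y1), (x2, y2)) ord0 i].

Definition maximal_class : set mapping :=
  [set F | constraint_class setT F /\
    ~ exists2 G, constraint_class setT G & graph setT F `<` graph setT G].

(* The members of the class over a finite [X] are finite datasets
   [{(x_i, f_i, g_i)}]: the same [x_i] may carry several [g_i], but only
   finitely many. Without this, [F(0) = {0} * R^d] would be a dataset for the
   subgradient inequality, and no convex function interpolates it. *)
Definition finite_data (X : set E) : set mapping :=
  [set F | [/\ finite_set X, constraint_class X F & finite_set (graph X F)]].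

(* A maximal map has the largest possible [g(x)], so interpolating a dataset
   means that the data lie on the graph: [F(x)] is included in [Fbar(x)],
   which forces the function values to agree. Equality of the sets of
   [g]-values is unattainable in general (take [p = 0]). *)
Definition interpolation_constraint : Prop :=
  forall (X : set E) (F : mapping), finite_data X F ->
    exists2 Fbar, maximal_class Fbar &
      forall x, X x -> values F x `<=` values Fbar x.

Definition regularly_extensible : Prop :=
  continuous p /\
  forall (X : set E) (F : mapping), finite_data X F ->
    exists Fbar, [/\ constraint_class (rational_points `|` X) Fbar,
      forall x, X x -> values Fbar x = values F x &
      forall x : nat -> E, (forall k, rational_points (x k)) ->
        cauchy (x @ \oo) ->
        forall y : nat -> R * E, (forall k, values Fbar (x k) (y k)) ->
          has_cvg_subseq y].

End Constraint.
End PairwiseConstraints.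

Arguments datum : clear implicits.
Arguments mapping : clear implicits.

(* Main.v *)
(** A dataset extends to [Fbar] on the rationals.  By continuity, the sign
    condition [p >= 0] passes from the graph of [Fbar] to its closure, and
    regular extensibility makes this closure meet every fibre [{x} * (R * R^d)]:
    approximate [x] by rationals and extract a convergent subsequence of values.
    Choosing one point [(f(x), g)] of the closure above each [x] and keeping all
    points of the closure with function value [f(x)] gives a member of the class
    on the whole space whose graph contains the data; Zorn's lemma makes it
    maximal. *)
Require Import Defs.
From mathcomp Require Import all_boot all_order all_algebra.
From mathcomp Require Import all_classical all_reals all_analysis.

Set Implicit Arguments.
Unset Strict Implicit.
Unset Printing Implicit Defensive.

Import Order.TTheory GRing.Theory Num.Theory.
Import numFieldNormedType.Exports.

Local Open Scope classical_set_scope.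
Local Open Scope ring_scope.

(** By induction, [n <= phi n]. *)
Lemma extraction_cvg (phi : nat -> nat) :
  {homo phi : m n / (m < n)%N} -> phi @ \oo --> \oo.
Proof.
move=> incr A [N _ NA]; exists N => // n /= Nn; apply: NA => /=.
apply: (leq_trans Nn); elim: n {Nn} => // n IHn.
exact: leq_ltn_trans IHn (incr _ _ (ltnSn n)).
Qed.

Section Extension.
Context {R : realType} {d : nat}.
Local Notation E := 'rV[R]_d.

Lemma rational_points_cvg (x : E) :
  exists2 u : nat -> E, (forall k, rational_points (u k)) & u @ \oo --> x.
Proof.
have near_rat k (j : 'I_d) :
    exists q : rat, ratr q \in `](x ord0 j), (x ord0 j + harmonic k)[.
  by apply: rat_in_itvoo; rewrite ltrDl /harmonic /= invr_gt0 ltr0n.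
have [q qP] := choice (fun kj : nat * 'I_d => near_rat kj.1 kj.2).
exists (fun k => map_mx ratr (\row_j q (k, j))); first by move=> k; eexists.
move=> A [P Px sPA].
have cvg_coord j : (ratr (q (k, j)) : R) @[k --> \oo] --> x ord0 j.
  apply: (@squeeze_cvgr _ _ _ _ (fun=> x ord0 j) (fun k => x ord0 j + harmonic k)).
  - near=> k; have := qP (k, j).
    by rewrite in_itv /= => /andP[/ltW -> /ltW ->].
  - exact: cvg_cst.
  - rewrite -[X in _ --> X]addr0; apply: cvgD; first exact: cvg_cst.
    exact: cvg_harmonic.
(* There are finitely many coordinates, so one rank serves them all. *)
have : \forall k \near \oo, forall j, P ord0 j (ratr (q (k, j))).
  by apply: filter_forall => j; apply: cvg_coord.
apply: filterS => k Pk; apply: sPA => i j.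
by rewrite ord1 !mxE; apply: Pk.
Unshelve. all: by end_near.
Qed.

Section Constraint.
Context {l : nat}.
Variable p : datum R d * datum R d -> 'rV[R]_l.

(** The sign condition on bare sets of data: a closure of a graph may carry several function values
    above one point, so it need not be the graph of a mapping. *)
Definition compatible (A : set (datum R d)) : Prop :=
  forall z1 z2, A z1 -> A z2 -> forall i, 0 <= p (z1, z2) ord0 i.

Lemma compatible_graph (X : set E) (F : mapping R d) :
  constraint_class p X F -> compatible (graph X F).
Proof. by move=> [_ pF] [x1 y1] [x2 y2] [/= ? ?] [/= ? ?]; apply: pF. Qed.

Lemma compatible_closure (A : set (datum R d)) :
  continuous p -> compatible A -> compatible (closure A).
Proof.
move=> cp cA z1 z2 z1A z2A i.
have cpi : continuous (fun w => p w ord0 i).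
  move=> w; apply: (@continuous_comp _ _ _ p (fun M => M ord0 i)); first exact: cp.
  exact: coord_continuous.
have := preimage_closed (in1W cpi) (@closed_ge R 0).
(* It remains to see that a pair of points of [closure A] is a limit of pairs from [A]: every
   neighbourhood contains a box [U] times [V]. *)
apply => B [[U V] [/= z1U z2V] UVB].
have [w1 [Aw1 Uw1]] := z1A _ z1U.
have [w2 [Aw2 Vw2]] := z2A _ z2V.
by exists (w1, w2); split; [exact: cA|exact: UVB].
Qed.

(** [G] has a value above every point, so any extension has the same function values. Only the
    [g]-part can grow, and Zorn's lemma is applied to sets of pairs [(x, g)]. *)
Lemma maximal_extension (G : mapping R d) : constraint_class p setT G ->
  exists2 F, maximal_class p F & graph setT G `<=` graph setT F.
Proof.
move=> [G0 pG].
pose f := fval G.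
(* Adjoining the values of [G] to [A] makes the empty chain harmless. *)
pose gr (A : set (E * E)) : set (datum R d) :=
  [set z | z.2.1 = f z.1 /\ (gval G z.1 z.2.2 \/ A (z.1, z.2.2))].
have [| A [cA maxA]] := @Zorn_bigcup _ [set A | compatible (gr A)].
  move=> C CP Ctot [x1 [_ g1]] [x2 [_ g2]] [/= -> z1] [/= -> z2].
  have in_gr (B : set (E * E)) x g :
      gval G x g \/ B (x, g) -> gr B (x, (f x, g)) by [].
  (* Two data involve at most two members of the chain, and the larger one contains both. *)
  case: z1 => [z1|[B1 CB1 z1]]; case: z2 => [z2|[B2 CB2 z2]].
  - by apply: pG.
  - by apply: (CP _ CB2); apply: in_gr; [left|right].
  - by apply: (CP _ CB1); apply: in_gr; [right|left].
  - by case: (Ctot _ _ CB1 CB2) => sB;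
      [apply: (CP _ CB2)|apply: (CP _ CB1)]; apply: in_gr; right => //; apply: sB.
pose F := Mapping f (fun x => [set g | gval G x g \/ A (x, g)]).
have grF x y : values F x y -> gr A (x, y) by case: y => y1 y2 [/= -> ].
exists F; last first.
  by move=> [x [y1 y2]] [_ [/= -> ?]]; split => //; split => //; left.
split.
  split=> [x _|x1 x2 y1 y2 _ _ /grF Fy1 /grF Fy2]; last exact: cA.
  by have [g Gg] := G0 x I; exists g; left.
move=> [H [H0 pH] [sFH nHF]]; apply: nHF => -[x [y1 y2]] [_ [/= -> Hy]].
have fH x' : f x' = fval H x'.
  have [g Gg] := G0 x' I.
  have := sFH (x', (f x', g)).
  by case=> [|_ [/= ->]] //; split=> //; split=> //; left.
pose B := [set z : E * E | gval H z.1 z.2].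
have sFB x' g : gval F x' g -> gval H x' g.
  move=> Fg; have := sFH (x', (f x', g)).
  by case=> [|_ [/= _ ]] //; split.
apply: contrapT => nF; apply: (maxA B).
  split=> [[x' g] Ag|sBA]; first by apply: sFB; right.
  apply: nF; split => //; split=> /=; first by rewrite fH.
  by right; apply: sBA.
move=> [x1 [_ g1]] [x2 [_ g2]] [/= -> z1] [/= -> z2].
apply: pH => //; split=> //=.
  by case: z1 => // z1; apply: sFB; left.
by case: z2 => // z2; apply: sFB; left.
Qed.

(** Rationals tending to [x] form a Cauchy sequence, so some values above them subconverge; their
    limit is the required [z]. *)
Lemma closure_graph_fiber (X : set E) (F : mapping R d) (x : E) :
  constraint_class p (rational_points `|` X) F ->
  (forall u : nat -> E, (forall k, rational_points (u k)) ->
    cauchy (u @ \oo) ->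
    forall y : nat -> R * E, (forall k, values F (u k) (y k)) ->
      has_cvg_subseq y) ->
  exists z, closure (graph (rational_points `|` X) F) (x, z).
Proof.
move=> [F0 _] Fsub; have [u uQ ux] := rational_points_cvg x.
have Fu k : exists y, values F (u k) y.
  by have [g Fg] := F0 _ (or_introl (uQ k)); exists (fval F (u k), g).
have [y Fy] := choice Fu.
have cauchy_u : cauchy (u @ \oo) by apply: cvg_cauchy; apply/cvg_ex; exists x.
have [phi [z [phi_incr yz]]] := Fsub u uQ cauchy_u y Fy.
exists z => B xzB.
have uphi : (u \o phi) @ \oo --> x.
  exact: cvg_comp (extraction_cvg phi_incr) ux.
have uyz : (u (phi k), y (phi k)) @[k --> \oo] --> (x, z).
  exact: cvg_pair uphi yz.
have [k Bk] : exists k, B (u (phi k), y (phi k)).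
  exact: (@filter_ex _ (nbhs \oo) _ _ (uyz B xzB)).
exists (u (phi k), y (phi k)); split; last exact: Bk.
by split; [left; exact: uQ|exact: Fy].
Qed.

End Constraint.
End Extension.

Theorem theorem1 (R : realType) (d l : nat) (hd : (0 < d)%N) (hl : (0 < l)%N)
    (p : datum R d * datum R d -> 'rV[R]_l) :
  regularly_extensible p -> interpolation_constraint p.
Proof.
move=> [cp extp] X F dataF.
have [Fb [cFb FbF Fbsub]] := extp X F dataF.
set D := _ `|` _ in cFb.
have cD := compatible_closure cp (compatible_graph cFb).
(* Above [D] the chosen point must be a value of [Fb]: an arbitrary point of the closure could have
   another function value and lose the data. *)
have fiber x : exists z, closure (graph D Fb) (x, z) /\ (D x -> values Fb x z).
  have [Dx|nDx] := pselect (D x); last first.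
    by have [z] := closure_graph_fiber x cFb Fbsub; exists z.
  have [g Fg] := cFb.1 x Dx; exists (fval Fb x, g); split=> //.
  by apply: subset_closure.
have [h hP] := choice fiber.
pose G := Mapping (fun x => (h x).1)
  (fun x => [set g | closure (graph D Fb) (x, ((h x).1, g))]).
have cG : constraint_class p setT G.
  split=> [x _|x1 x2 [f1 g1] [f2 g2] _ _ [/= -> ?] [/= -> ?]]; last exact: cD.
  by exists (h x).2; rewrite /= -surjective_pairing; apply: (hP x).1.
have [Fm maxFm GFm] := maximal_extension cG.
exists Fm => // x Xx [f g]; rewrite -FbF // => -[/= fE Fg].
have Dx : D x by right.
have [hE _] := (hP x).2 Dx.
apply: (GFm (x, (f, g)) _).2; split => //; split => /=; rewrite hE //.
by apply: subset_closure.
Qed.
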